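(* Let $n\in\mathbb{N}$, let $R$ be a ring, and let $a,b\in R$. Then $1-ab$ has a generalized $n$-strongly Drazin inverse if and only if $1-ba$ has a generalized $n$-strongly Drazin inverse.
   Context: All rings are associative with identity; $n$ is a fixed natural number, $\mathbb{N}=\{1,2,3,\dots\}$. $U(R)$ is the set of units of $R$. For $a\in R$, the commutant is $\mathrm{comm}(a)=\{x\in R : xa=ax\}$ and the double commutant is $\mathrm{comm}^2(a)=\{x\in R : xy=yx \text{ for all } y\in \mathrm{comm}(a)\}$. Set $R^{qnil}=\{a\in R : 1+ax\in U(R)\text{ for every }x\in \mathrm{comm}(a)\}$ (the quasinilpotent elements). An element $a\in R$ has a generalized $n$-strongly Drazin inverse if there exists $x\in R$ such that $xax=x$, $x\in \mathrm{comm}^2(a)$ and $a^n-ax\in R^{qnil}$. *)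

(* Defs.v *)
From HB Require Import structures.
From mathcomp Require Import all_boot all_order all_algebra.
Set Implicit Arguments.
Unset Strict Implicit.
Unset Printing Implicit Defensive.
Import GRing.Theory.
Local Open Scope ring_scope.

(* Rings are pzRingType, so the zero ring is allowed. That structure carries
   no GRing.unit predicate; is_unit is the characterization of GRing.unit given
   by unitrP in a unitRingType. *)
Definition is_unit (R : pzRingType) (u : R) : Prop :=
  exists v : R, v * u = 1 /\ u * v = 1.

Definition commutant (R : pzRingType) (a x : R) : Prop := GRing.comm x a.

Definition double_commutant (R : pzRingType) (a x : R) : Prop :=
  forall y : R, commutant a y -> GRing.comm x y.

Definition quasinilpotent (R : pzRingType) (a : R) : Prop :=
  forall x : R, commutant a x -> is_unit (1 + a * x).

Definition has_gen_strongly_drazin_inverse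
    (R : pzRingType) (n : nat) (a : R) : Prop :=
  exists x : R,
    [/\ x * a * x = x, double_commutant a x & quasinilpotent (a ^+ n - a * x)].

(* Main.v *)
Require Import Defs.
From mathcomp Require Import all_boot all_order all_algebra.
Import GRing.Theory.
Local Open Scope ring_scope.

(** The statement is symmetric in [a] and [b], so one implication suffices.
    Write [A = 1 - ab] and [B = 1 - ba]; they are intertwined by [A a = a B] and
    [B b = b A].  Let [x] be the given inverse of [A] and [p = 1 - A x] its
    spectral idempotent.

    The element [1 - A p] is invertible: it divides [1 - (A p)^n], and
    [(A p)^n = (A^n - A x) p] is a product of a quasinilpotent element with an
    element commuting with it.  So [ab = 1 - A] is invertible on the corner of
    [p]: there is [v] in the double commutant of [A] with [v p = v] and
    [ab v = p].  Cline's formula then moves [p] to the idempotent [q = b v a] of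
    the double commutant of [B] ([double_commutant_swap]), and
    [s = 1 - q + b x a] is an inverse of [B] on the corner of [1 - q].

    What remains is that [B^n - B s = B^n - 1 + q] is quasinilpotent.  With
    [r = 1 + A + ... + A^(n-1)] one has [A^n = 1 - ab r] and [B^n = 1 - b r a],
    hence [A^n - A x = a (b (v - r))] and [B^n - B s = (b (v - r)) a].  These are
    the two products of the same pair of elements, and quasinilpotence passes
    from one product to the other ([quasinilpotent_swap]). *)

(** * Units and commutation *)

Lemma is_unit_comm_factor (R : pzRingType) (s t : R) :
  GRing.comm s t -> is_unit (s * t) -> is_unit s.
Proof.
move=> st [w [wst stw]].
(* [w t] is a left inverse and [t w] a right inverse, so they agree. *)
have lst : w * t * s = 1 by rewrite -mulrA -st.
exists (w * t); split=> //.
have -> : w * t = t * w by rewrite -[LHS]mulr1 -stw !mulrA lst mul1r.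
by rewrite mulrA.
Qed.

Lemma is_unit_1sub_expr (R : pzRingType) (n : nat) (t : R) :
  is_unit (1 - t ^+ n) -> is_unit (1 - t).
Proof.
have -> : 1 - t ^+ n = (1 - t) * \sum_(i < n) t ^+ i.
  by rewrite -[LHS]opprB subrX1 -mulNr opprB.
apply: is_unit_comm_factor; apply: commr_sum => i _.
by apply/commrX/commr_sym/commrB => //; apply: commr1.
Qed.

Lemma is_unit_1sub_swap (R : pzRingType) (s t : R) :
  is_unit (1 - s * t) -> is_unit (1 - t * s).
Proof.
move=> [w [w1 w2]]; exists (1 + t * w * s).
have e1 : w * s * t = w - 1 by rewrite -w1 mulrBr mulr1 opprB addrC subrK mulrA.
have e2 : s * t * w = w - 1 by rewrite -w2 mulrBl mul1r opprB addrC subrK.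
split.
- rewrite mulrBr mulr1 mulrDl mul1r.
  have -> : t * w * s * (t * s) = t * (w * s * t) * s by rewrite !mulrA.
  by rewrite e1 mulrBr mulr1 mulrBl addrCA subrr addr0 addrK.
- rewrite mulrBl mul1r mulrDr mulr1.
  have -> : t * s * (t * w * s) = t * (s * t * w) * s by rewrite !mulrA.
  by rewrite e2 mulrBr mulr1 mulrBl addrCA subrr addr0 addrK.
Qed.

Lemma comm_inverse (R : pzRingType) (y t w : R) :
  w * t = 1 -> t * w = 1 -> GRing.comm y t -> GRing.comm y w.
Proof.
move=> wt tw yt; rewrite /GRing.comm.
by rewrite -[LHS]mul1r -wt -!mulrA (mulrA t) -yt -mulrA tw mulr1.
Qed.

Lemma commutant_1sub (R : pzRingType) (t y : R) :
  commutant (1 - t) y <-> commutant t y.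
Proof.
split=> yt; last by apply: commrB => //; apply: commr1.
have -> : t = 1 - (1 - t) by rewrite opprB addrC subrK.
by apply: commrB => //; apply: commr1.
Qed.

(** * From one product of two elements to the other *)

(** If [y] commutes with [ts], then [1 + tsy] divides
    [1 - (tsy)^2 = 1 - t (s y^2 ts)], which is a unit together with
    [1 - st (s y^2 t)]; and [s y^2 t] commutes with [st]. *)
Lemma quasinilpotent_swap (R : pzRingType) (s t : R) :
  quasinilpotent (s * t) -> quasinilpotent (t * s).
Proof.
move=> qst y; rewrite /commutant => yts.
suff: is_unit (1 - (- (t * s * y)) ^+ 2).
  by move/is_unit_1sub_expr; rewrite opprK.
rewrite sqrrN.
have -> : (t * s * y) ^+ 2 = t * (s * (y * y) * t * s).
  have -> : t * (s * (y * y) * t * s) = t * s * y * (y * (t * s)).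
    by rewrite !mulrA.
  by rewrite yts expr2.
apply: is_unit_1sub_swap.
have cw : commutant (s * t) (s * (y * y) * t).
  rewrite /commutant /GRing.comm.
  have -> : s * (y * y) * t * (s * t) = s * (y * (y * (t * s))) * t.
    by rewrite !mulrA.
  by rewrite yts (mulrA y) yts !mulrA.
have -> : s * (y * y) * t * s * t = s * t * (s * (y * y) * t).
  by rewrite -cw !mulrA.
by rewrite -mulrN; apply: qst; apply/commr_sym/commrN/commr_sym; apply: cw.
Qed.

(** An outer inverse [v] of [st] commuting with [st] satisfies [v = st v^2], so
    [t v s = ts (t v^2 s)] has a factor [ts] that any [y] commuting with [ts]
    can cross.  The element [s y t], which commutes with [st], then carries [y]
    past [v^2]. *)
Lemma double_commutant_swap (R : pzRingType) (s t v : R) :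
  double_commutant (s * t) v -> v * (s * t) * v = v ->
  double_commutant (t * s) (t * v * s).
Proof.
move=> vc vv y; rewrite /commutant => yts.
have vst : GRing.comm v (s * t) by apply: vc.
have vsyt : GRing.comm v (s * y * t).
  apply: vc; rewrite /commutant /GRing.comm.
  have -> : s * y * t * (s * t) = s * (y * (t * s)) * t by rewrite !mulrA.
  by rewrite yts !mulrA.
have vvsyt : GRing.comm (v * v) (s * y * t).
  by apply/commr_sym/commrM; apply: commr_sym.
have vl : v = s * t * (v * v) by rewrite mulrA -vst vv.
have vr : v = v * v * (s * t) by rewrite -mulrA vst mulrA vv.
rewrite /GRing.comm; symmetry.
have -> : y * (t * v * s) = y * (t * s) * t * (v * v) * s.
  by rewrite {1}vl !mulrA.
rewrite yts.
have -> : t * s * y * t * (v * v) * s = t * (s * y * t * (v * v)) * s.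
  by rewrite !mulrA.
rewrite -vvsyt.
have -> : t * (v * v * (s * y * t)) * s = t * (v * v) * s * (y * (t * s)).
  by rewrite !mulrA.
rewrite yts.
have -> : t * (v * v) * s * (t * s * y) = t * (v * v * (s * t)) * s * y.
  by rewrite !mulrA.
by rewrite -vr.
Qed.

Lemma expr_1sub_swap (R : pzRingType) (n : nat) (s t : R) :
  (1 - t * s) ^+ n = 1 - t * (\sum_(i < n) (1 - s * t) ^+ i) * s.
Proof.
have shift i : s * (1 - t * s) ^+ i = (1 - s * t) ^+ i * s.
  elim: i => [|i IH]; first by rewrite !expr0 mulr1 mul1r.
  rewrite exprSr mulrA IH exprSr -!mulrA; congr (_ * _).
  by rewrite mulrBr mulrBl mulr1 mul1r !mulrA.
rewrite -[LHS](subrK 1) subrX1 addrAC subrr add0r mulNr addrC; congr (1 - _).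
rewrite -!mulrA mulr_sumr mulr_suml; congr (_ * _).
by apply: eq_bigr => i _; apply: shift.
Qed.

(** * Outer inverses and their spectral idempotents *)

(** On the corner of [e] the element [w] is the inverse of [t], so it commutes
    with whatever commutes with both [t] and [e]. *)
Lemma double_commutant_outer_inverse (R : pzRingType) (t w e : R) :
  double_commutant t e -> t * w = e -> w * t = e -> e * w = w -> w * e = w ->
  double_commutant t w.
Proof.
move=> ec tw wt ew we y; rewrite /commutant => yt.
have ey : GRing.comm e y by apply: ec.
rewrite /GRing.comm -{1}we -mulrA ey -tw !mulrA -(mulrA w y) yt !mulrA wt ey.
by rewrite -mulrA ew.
Qed.

(** The quasinilpotence of [t^n - tw] makes [1 - t(1 - tw)] a unit, and its
    inverse cut down to the corner of [1 - tw] is the inverse of [1 - t] there. *)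
Lemma spectral_corner_inverse (R : pzRingType) (n : nat) (t w : R) :
  (0 < n)%N -> w * t * w = w -> double_commutant t w ->
  quasinilpotent (t ^+ n - t * w) ->
  exists v : R, [/\ double_commutant t v, v * (1 - t * w) = v,
    v * (1 - t) = 1 - t * w & (1 - t) * v = 1 - t * w].
Proof.
move=> n0 wtw wc qt.
set p := 1 - t * w.
have pc : double_commutant t p.
  move=> y cy; apply/commr_sym/commrB; first exact: commr1.
  by apply: commrM; [apply: cy | apply/commr_sym/wc].
have pt : GRing.comm p t by apply: pc.
have pp : p * p = p.
  rewrite {2}/p mulrBr mulr1 /p mulrBl mul1r.
  by rewrite -!mulrA (mulrA w) wtw subrr subr0.
have tpn : (t * p) ^+ n = (t ^+ n - t * w) * p.
  have -> : t * w = 1 - p by rewrite /p opprB addrC subrK.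
  rewrite exprMn_comm; last exact: commr_sym.
  rewrite mulrBl mulrBl mul1r pp subrr subr0; congr (_ * _).
  by case: n n0 {qt} => // m _; elim: m => // m IH; rewrite exprS IH.
clearbody p.
have [u [u1 u2]] : is_unit (1 - t * p).
  apply: (is_unit_1sub_expr _ n); rewrite tpn -mulrN; apply: qt.
  have cpw : GRing.comm p w by apply/commr_sym/wc; exact: pt.
  apply/commr_sym/commrN/commr_sym; apply: commrB; first exact: commrX.
  exact: commrM.
have uc y : GRing.comm y t -> GRing.comm y u.
  move=> yt; apply: (comm_inverse _ _ _ _ u1 u2); apply: commrB; first exact: commr1.
  by apply: commrM => //; apply/commr_sym/pc.
have pu : GRing.comm p u by apply: uc.
have tu : GRing.comm t u by apply: uc.
have ptp : p * (1 - t * p) = p * (1 - t).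
  by rewrite !mulrBr mulr1 mulrA pt -mulrA pp -pt.
have v1 : p * u * (1 - t) = p by rewrite pu -mulrA -ptp mulrA -pu -mulrA u1 mulr1.
exists (p * u); split=> //.
- move=> y cy; apply/commr_sym/commrM; first by apply/commr_sym/pc.
  exact: uc.
- by rewrite -mulrA -pu mulrA pp.
- rewrite -[RHS]v1; apply/commr_sym/commrB; first exact: commr1.
  by apply/commr_sym/commrM; [apply: commr_sym | apply: tu].
Qed.

(** * The transfer *)

Lemma has_gen_strongly_drazin_inverse_swap
    (R : pzRingType) (n : nat) (a b : R) : (0 < n)%N ->
  has_gen_strongly_drazin_inverse n (1 - a * b) ->
  has_gen_strongly_drazin_inverse n (1 - b * a).
Proof.
move=> n0 [x [xAx xc qA]].
have [v [vc]] := spectral_corner_inverse _ _ _ _ n0 xAx xc qA.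
set A := 1 - a * b in xAx xc qA vc *; set B := 1 - b * a.
have -> : 1 - A = a * b by rewrite /A opprB addrC subrK.
set p := 1 - A * x => vp vab abv.
have xA : GRing.comm x A by apply: xc.
have vA : GRing.comm v A by apply: vc.
have vx : GRing.comm v x by apply/commr_sym/xc; exact: vA.
have px0 : p * x = 0 by rewrite /p mulrBl mul1r -xA xAx subrr.
have pv : p * v = v by rewrite -vab -mulrA abv vp.
have bA : B * b = b * A by rewrite /A /B mulrBl mulrBr mul1r mulr1 mulrA.
have aB : A * a = a * B by rewrite /A /B mulrBl mulrBr mul1r mulr1 mulrA.
have vx0 : v * x = 0 by rewrite -vp -mulrA px0 mulr0.
have Ax : A * x = 1 - p by rewrite /p opprB addrC subrK.
pose q := b * v * a.
have qc : double_commutant B q.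
  move=> y /commutant_1sub; apply: double_commutant_swap; last by rewrite vab.
  by move=> z cz; apply: vc; apply/commutant_1sub.
have qq : q * q = q.
  have -> : q * q = b * (v * (a * b) * v) * a by rewrite /q !mulrA.
  by rewrite vab pv.
have qB : GRing.comm q B by apply: qc.
have baq : b * a * q = b * p * a.
  have -> : b * a * q = b * (a * b * v) * a by rewrite /q !mulrA.
  by rewrite abv.
have qE : q = b * v * a by [].
(* [ab] commutes with [v] and [x], so [vx = 0] makes [q] and [bxa] orthogonal. *)
have abx : GRing.comm (a * b) x.
  by apply/commr_sym/commutant_1sub.
have qbxa : q * (b * x * a) = 0.
  have -> : q * (b * x * a) = b * (v * (a * b * x)) * a by rewrite /q !mulrA.
  by rewrite abx (mulrA v) vx0 mul0r mulr0 mul0r.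
have bxaq : b * x * a * q = 0.
  have -> : b * x * a * q = b * (x * (a * b) * v) * a by rewrite /q !mulrA.
  by rewrite -abx -(mulrA (a * b)) -vx vx0 !mulr0 mul0r.
have eq1 : (1 - q) * (1 - q) = 1 - q.
  by rewrite mulrBr mulr1 mulrBl mul1r qq subrr subr0.
clearbody q.
pose s := 1 - q + b * x * a.
have es : (1 - q) * s = s by rewrite mulrDr eq1 mulrBl mul1r qbxa subr0.
have se : s * (1 - q) = s by rewrite mulrDl eq1 mulrBr mulr1 bxaq subr0.
have bxaB : GRing.comm (b * x * a) B.
  rewrite /GRing.comm -mulrA -aB !mulrA bA -!mulrA; congr (_ * _).
  by rewrite !mulrA xA.
have sB : GRing.comm s B.
  apply/commr_sym/commrD; last exact: commr_sym.
  by apply: commrB; [apply: commr1 | apply: commr_sym].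
have Bs : B * s = 1 - q.
  have Bbxa : B * (b * x * a) = b * a - b * a * q.
    by rewrite !mulrA bA -(mulrA b A) Ax mulrBr mulr1 mulrBl -baq.
  by rewrite mulrDr Bbxa {1}/B mulrBl mul1r mulrBr mulr1 subrK.
have ec : double_commutant B (1 - q).
  move=> y cy; apply/commr_sym/commrB; first exact: commr1.
  exact/commr_sym/qc.
exists s; split.
- by rewrite sB Bs es.
- apply: (@double_commutant_outer_inverse _ B s (1 - q)) => //.
  by rewrite sB.
- pose r := \sum_(i < n) A ^+ i.
  have Ar : GRing.comm A r by apply: commr_sum => i _; apply: commrX.
  have An : A ^+ n = 1 - a * b * r.
    rewrite -[LHS](subrK 1) subrX1 -/r {1}/A addrAC subrr add0r mulNr.
    by rewrite addrC.
  have eA : A ^+ n - A * x = a * (b * (v - r)).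
    rewrite An Ax mulrA mulrBr abv opprB addrC.
    by rewrite addrA subrK.
  have eB : B ^+ n - B * s = b * (v - r) * a.
    rewrite Bs /B expr_1sub_swap -/A -/r mulrBr mulrBl -qE opprB addrC.
    by rewrite addrA subrK.
  by rewrite eB; apply: quasinilpotent_swap; rewrite -eA.
Qed.

Theorem theorem2p3 (n : nat) (hn : (0 < n)%N) (R : pzRingType) (a b : R) :
  has_gen_strongly_drazin_inverse n (1 - a * b) <->
  has_gen_strongly_drazin_inverse n (1 - b * a).
Proof. by split; apply: has_gen_strongly_drazin_inverse_swap. Qed.
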